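(* Let $\mathbf{z}\in K_{\exp}^*$ with $z_x=0$, $z_y>0$ and $z_z>0$, so that $\{\mathbf{z}\}^\perp\cap K_{\exp}=\mathcal{F}_\infty$. Let $\eta>0$ and let $$\gamma_{\mathbf{z},\eta}:=\inf_{\mathbf{v}}\left\{\frac{\|\mathbf{w}-\mathbf{v}\|}{\|\mathbf{w}-\mathbf{u}\|}\;\Big|\;\mathbf{v}\in\partial K_{\exp}\cap B(\eta)\setminus\mathcal{F}_\infty,\ \mathbf{w}=P_{\{\mathbf{z}\}^\perp}\mathbf{v},\ \mathbf{u}=P_{\mathcal{F}_\infty}\mathbf{w},\ \mathbf{w}\ne\mathbf{u}\right\}.$$ Then $\gamma_{\mathbf{z},\eta}\in(0,\infty]$ and $$\mathrm{d}(\mathbf{q},\mathcal{F}_\infty)\le\max\{2,2\gamma_{\mathbf{z},\eta}^{-1}\}\cdot\mathrm{d}(\mathbf{q},K_{\exp})\quad\text{whenever } \mathbf{q}\in\{\mathbf{z}\}^\perp\cap B(\eta).$$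
   Context: $\mathbb{R}^3$ carries the standard inner product and Euclidean norm; vectors are written $\mathbf{p}=(p_x,p_y,p_z)$. $K_{\exp}=\{(x,y,z):y>0,\ z\ge ye^{x/y}\}\cup\{(x,y,z):x\le0,\ z\ge0,\ y=0\}$ is the exponential cone, $K_{\exp}^*$ its dual cone, $\partial K_{\exp}$ its boundary, and $\mathcal{F}_\infty=\{(x,0,0):x\le0\}$. $B(\eta)$ is the closed ball of radius $\eta$ centered at the origin, $\mathrm{d}(\cdot,C)$ the distance to $C$, $P_C$ the orthogonal projection onto the closed convex set $C$. Conventions: infimum over the empty set is $+\infty$ and $1/\infty=0$. *)

(* Defs.v *)
From HB Require Import structures.
From mathcomp Require Import all_boot all_order all_algebra.
From mathcomp Require Import all_classical all_reals all_analysis.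

Set Implicit Arguments.
Unset Strict Implicit.
Unset Printing Implicit Defensive.

Import Order.TTheory GRing.Theory Num.Theory.
Import numFieldNormedType.Exports.

Local Open Scope classical_set_scope.
Local Open Scope ring_scope.

(* The library norm on row vectors is the max norm, so the Euclidean structure
   is defined here; both norms induce the topology used in [boundary]. *)
Definition inner (R : realType) n (u v : 'rV[R]_n) : R := (u *m v^T) 0 0.

Definition enorm (R : realType) n (u : 'rV[R]_n) : R := Num.sqrt (inner u u).

Definition eball (R : realType) n (eta : R) : set 'rV[R]_n :=
  [set u | enorm u <= eta].

Definition orthocompl (R : realType) n (A : set 'rV[R]_n) : set 'rV[R]_n :=
  [set u | forall a, A a -> inner u a = 0].

Definition dual_cone (R : realType) n (K : set 'rV[R]_n) : set 'rV[R]_n :=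
  [set u | forall x, K x -> 0 <= inner x u].

Definition edist_to (R : realType) n (C : set 'rV[R]_n) (q : 'rV[R]_n) :
    \bar R :=
  ereal_inf [set (enorm (q - p))%:E | p in C].

(* [is_proj C v w] reads w = P_C v: w is a point of C nearest to v. Such a
   point exists and is unique when C is nonempty, closed and convex. *)
Definition is_proj (R : realType) n (C : set 'rV[R]_n) (v w : 'rV[R]_n) :=
  C w /\ forall p, C p -> enorm (v - w) <= enorm (v - p).

Definition boundary (T : topologicalType) (A : set T) : set T :=
  closure A `\` interior A.

Section ExponentialCone.
Variable R : realType.
Implicit Types p v z : 'rV[R]_3.

Definition xc p : R := p 0 0.
Definition yc p : R := p 0 1.
Definition zc p : R := p 0 2.

Definition Kexp : set 'rV[R]_3 :=
  [set p | 0 < yc p /\ yc p * expR (xc p / yc p) <= zc p] `|`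
  [set p | [/\ xc p <= 0, 0 <= zc p & yc p = 0]].

Definition Finf : set 'rV[R]_3 :=
  [set p | [/\ xc p <= 0, yc p = 0 & zc p = 0]].

(* [ereal_inf set0 = +oo], as required by the convention on infima. *)
Definition gamma z (eta : R) : \bar R :=
  ereal_inf [set r | exists v w u : 'rV[R]_3,
    [/\ ((boundary Kexp `&` eball eta) `\` Finf) v,
        is_proj (orthocompl [set z]) v w,
        is_proj Finf w u,
        w <> u &
        r = (enorm (w - v) / enorm (w - u))%:E]].

End ExponentialCone.

Arguments Kexp {R}.
Arguments Finf {R}.

(* Main.v *)
(** The constant gamma compares, for v on the boundary of the cone, the two
    legs of the path v -> w -> u. Let q be in the hyperplane and p in the cone.
    No nearest point of the cone is required: the multiple of p closest to q is
    in the cone, no farther from q than p, and of norm at most |q|, so the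
    segment from it to q meets the boundary at some v in the ball with
    |q - v| <= |q - p|. If v is not in Finf, then
    |q - u| <= |q - w| + |w - u| <= |q - v| + |w - v| / gamma
            <= (1 + 1 / gamma) |q - v|.

    Positivity of gamma comes from the cone lying in
    {y >= 0, z >= 0, x <= z}. There v is at distance O(v_y + v_z) from Finf,
    while |w - v| is at least a multiple of <v, z>, hence of v_y + v_z. *)

Require Import Defs.
From mathcomp Require Import all_boot all_order all_algebra.
From mathcomp Require Import all_classical all_reals all_analysis.
From mathcomp Require Import ring lra.
Import Order.TTheory GRing.Theory Num.Theory.
Import numFieldNormedType.Exports.
Local Open Scope classical_set_scope.
Local Open Scope ring_scope.

Set Implicit Arguments.
Unset Strict Implicit.

(** * Euclidean geometry of row vectors *)

Section InnerProduct.
Context (R : realType) (n : nat).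
Implicit Types (u v w p q : 'rV[R]_n) (a : R).

Lemma innerE u v : inner u v = \sum_i u 0 i * v 0 i.
Proof. by rewrite /inner mxE; apply: eq_bigr => i _; rewrite mxE. Qed.

Lemma innerC u v : inner u v = inner v u.
Proof. by rewrite !innerE; apply: eq_bigr => i _; rewrite mulrC. Qed.

Lemma innerDl u v w : inner (u + v) w = inner u w + inner v w.
Proof. by rewrite /inner mulmxDl mxE. Qed.

Lemma innerZl a u v : inner (a *: u) v = a * inner u v.
Proof. by rewrite /inner -scalemxAl mxE. Qed.

Lemma innerNl u v : inner (- u) v = - inner u v.
Proof. by rewrite -scaleN1r innerZl mulN1r. Qed.

Lemma innerDr u v w : inner w (u + v) = inner w u + inner w v.
Proof. by rewrite !(innerC w) innerDl. Qed.

Lemma innerZr a u v : inner v (a *: u) = a * inner v u.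
Proof. by rewrite !(innerC v) innerZl. Qed.

Lemma innerNr u v : inner v (- u) = - inner v u.
Proof. by rewrite !(innerC v) innerNl. Qed.

Lemma inner0l u : inner 0 u = 0.
Proof. by rewrite -(scale0r 0) innerZl mul0r. Qed.

Lemma inner0r u : inner u 0 = 0.
Proof. by rewrite innerC inner0l. Qed.

Definition inner_linear :=
  (innerDl, innerDr, innerZl, innerZr, innerNl, innerNr).

Lemma inner_ge0 u : 0 <= inner u u.
Proof. by rewrite innerE sumr_ge0// => i _; rewrite -expr2 sqr_ge0. Qed.

Lemma inner_eq0 u : inner u u = 0 -> u = 0.
Proof.
rewrite innerE => /psumr_eq0P u0; apply/rowP => i; rewrite mxE.
apply/eqP; rewrite -sqrf_eq0 expr2 u0// => j _.
by rewrite -expr2 sqr_ge0.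
Qed.

Lemma inner_gt0 u : u != 0 -> 0 < inner u u.
Proof.
move=> u0; rewrite lt_neqAle inner_ge0 andbT eq_sym.
by apply: contra_neq u0 => /inner_eq0.
Qed.

Lemma enorm_ge0 u : 0 <= enorm u.
Proof. exact: sqrtr_ge0. Qed.

Lemma sqr_enorm u : enorm u ^+ 2 = inner u u.
Proof. by rewrite sqr_sqrtr// inner_ge0. Qed.

Lemma enorm0 : enorm (0 : 'rV[R]_n) = 0.
Proof. by rewrite /enorm inner0l sqrtr0. Qed.

Lemma enorm_eq0 u : enorm u = 0 -> u = 0.
Proof. by move=> u0; apply: inner_eq0; rewrite -sqr_enorm u0 expr0n. Qed.

Lemma le_enorm u v : inner u u <= inner v v -> enorm u <= enorm v.
Proof. exact: ler_wsqrtr. Qed.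

Lemma enormZ a u : enorm (a *: u) = `|a| * enorm u.
Proof.
by rewrite /enorm !inner_linear mulrA -expr2 sqrtrM ?sqr_ge0// sqrtr_sqr.
Qed.

Lemma enormN u : enorm (- u) = enorm u.
Proof. by rewrite -scaleN1r enormZ normrN1 mul1r. Qed.

Lemma enormB u v : enorm (u - v) = enorm (v - u).
Proof. by rewrite -enormN opprB. Qed.

Lemma sqr_inner_le u v : inner u v ^+ 2 <= inner u u * inner v v.
Proof.
have [->|v0] := eqVneq v 0.
  by rewrite !inner0r expr0n mulr0.
have vv := inner_gt0 v0.
(* This square equals [inner v v] times the Cauchy-Schwarz gap, so dividing by [inner v v > 0]
   suffices. *)
have := inner_ge0 (inner v v *: u - inner u v *: v).
rewrite !inner_linear (innerC v u) => H.
by rewrite -subr_ge0 -(pmulr_rge0 _ vv); apply: le_trans H _; lra.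
Qed.

Lemma inner_le u v : inner u v <= enorm u * enorm v.
Proof.
rewrite /enorm -sqrtrM ?inner_ge0//; apply: le_trans (ler_norm _) _.
by rewrite -sqrtr_sqr ler_wsqrtr// sqr_inner_le.
Qed.

Lemma ler_enormD u v : enorm (u + v) <= enorm u + enorm v.
Proof.
rewrite -ler_sqr ?nnegrE ?addr_ge0 ?enorm_ge0// sqrrD !sqr_enorm.
by rewrite !inner_linear (innerC v u); have := inner_le u v; lra.
Qed.

(* [s *: p] is the projection of [q] on the ray spanned by [p]. *)
Lemma closer_on_ray p q : exists s : R, [/\ 0 <= s,
  enorm (q - s *: p) <= enorm (q - p) & enorm (s *: p) <= enorm q].
Proof.
have [qp|qp] := leP (inner q p) 0.
  exists 0; rewrite scale0r subr0; split=> //; last first.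
    by rewrite enorm0 enorm_ge0.
  apply: le_enorm; rewrite !inner_linear (innerC p q).
  by have := inner_ge0 p; lra.
have p0 : p != 0.
  by apply: contraTneq qp => ->; rewrite inner0r ltxx.
have pp := inner_gt0 p0.
set s := inner q p / inner p p.
have sE : s * inner p p = inner q p by rewrite divfK// gt_eqF.
exists s; split; first by rewrite divr_ge0// ltW.
  apply: le_enorm; rewrite !inner_linear (innerC p q) -sE.
  (* This is exactly $|q - p|^2 - |q - sp|^2$, because $\langle q, p\rangle = s|p|^2$. *)
  have : 0 <= (1 - s) ^+ 2 * inner p p by rewrite mulr_ge0 ?sqr_ge0// ltW.
  by lra.
apply: le_enorm; rewrite !inner_linear -(ler_pM2r pp).
by have := sqr_inner_le q p; rewrite -sE; lra.
Qed.

End InnerProduct.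

(** * Projection on a hyperplane, and crossing the boundary of a set *)

Lemma orthocompl_is_proj (R : realType) n (z v : 'rV[R]_n) : z != 0 ->
  exists2 w, is_proj (orthocompl [set z]) v w &
    forall a, inner a z = 0 -> enorm (a - w) <= enorm (a - v).
Proof.
move=> /inner_gt0 zz; set c := inner v z / inner z z.
have cE : c * inner z z = inner v z by rewrite divfK// gt_eqF.
(* Pythagoras at the foot [v - c *: z]. Dropping the second summand shows that the foot is nearest
   to [v]; dropping the first shows that it is nearer than [v] to every point of the hyperplane. *)
have pyth a : inner a z = 0 ->
    inner (v - a) (v - a) = inner (v - (v - c *: z)) (v - (v - c *: z)) +
                            inner (a - (v - c *: z)) (a - (v - c *: z)).
  move=> az; rewrite opprB addrCA subrr addr0 !inner_linear.
  by rewrite (innerC z v) (innerC z a) (innerC v a) -cE az; ring.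
exists (v - c *: z).
  split=> [_ ->|p /(_ z erefl) pz]; first by rewrite !inner_linear cE subrr.
  by apply: le_enorm; rewrite (pyth _ pz) lerDl inner_ge0.
move=> a az; rewrite (enormB a v); apply: le_enorm.
by rewrite (pyth _ az) lerDr inner_ge0.
Qed.

(** If [B] missed the boundary, the closure and the interior of [A] would have the same trace on
    [B]. That trace would be nonempty and clopen in [B], hence all of [B], which contradicts the
    point outside [A]. *)
Lemma connected_meets_boundary (T : topologicalType) (A B : set T) :
  connected B -> B `&` A !=set0 -> B `\` A !=set0 -> B `&` boundary A !=set0.
Proof.
move=> cB [a [Ba Aa]] [b [Bb nAb]]; apply: contrapT => noboundary.
have BA : B `&` closure A = B `&` interior A.
  apply/seteqP; split=> x [Bx Ax]; split => //; last first.
    by apply: subset_closure; exact: interior_subset.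
  by apply: contrapT => nAx; apply: noboundary; exists x.
suff AB : B `&` interior A = B.
  by apply: nAb; apply: interior_subset; rewrite -AB in Bb; case: Bb.
apply: cB.
- by exists a; rewrite -BA; split => //; exact: subset_closure.
- by exists (interior A) => //; exact: open_interior.
- by exists (closure A); [exact: closed_closure | rewrite BA].
Qed.

Lemma segment_meets_boundary (R : realType) (V : normedModType R) (A : set V)
    (a b : V) :
  A a -> ~ A b -> exists2 s, 0 <= s <= 1 & boundary A (a + s *: (b - a)).
Proof.
move=> Aa nAb; pose f (s : R) := a + s *: (b - a).
have cf : continuous f.
  move=> s; apply: cvgD; first exact: cvg_cst.
  by apply: cvgZr_tmp; exact: cvg_id.
have cfs : {within `[0, 1], continuous f} by exact: continuous_subspaceT.
have cI := connected_continuous_connected (@segment_connected R 0 1) cfs.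
have := @connected_meets_boundary _ A _ cI.
case=> [||v [[s /= s01 <-] bs]].
- exists a; split => //; exists 0; rewrite /= ?in_itv/= ?lexx ?ler01//.
  by rewrite /f scale0r addr0.
- exists b; split => //; exists 1; rewrite /= ?in_itv/= ?lexx ?ler01//.
  by rewrite /f scale1r addrC subrK.
- by exists s => //; move: s01; rewrite in_itv.
Qed.

(** * The exponential cone, its face, and the error bound for a real constant *)

Section ExponentialConeFacts.
Context (R : realType).
Implicit Types p v w u q z : 'rV[R]_3.

Lemma inner3E u v : inner u v = xc u * xc v + yc u * yc v + zc u * zc v.
Proof.
rewrite innerE !big_ord_recl big_ord0 addr0 addrA /xc /yc /zc.
by do ![congr (_ + _)]; congr (u 0 _ * v 0 _); exact: val_inj.
Qed.

Lemma coord3B u v : (xc (u - v) = xc u - xc v) * (yc (u - v) = yc u - yc v) *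
  (zc (u - v) = zc u - zc v).
Proof. by rewrite /xc /yc /zc !mxE. Qed.

Lemma coord3Z (s : R) p : (xc (s *: p) = s * xc p) * (yc (s *: p) = s * yc p) *
  (zc (s *: p) = s * zc p).
Proof. by rewrite /xc /yc /zc !mxE. Qed.

Lemma Kexp_bounds p : Kexp p -> [/\ 0 <= yc p, 0 <= zc p & xc p <= zc p].
Proof.
case=> [[y0 yz]|[x0 z0 ->]]; last by split=> //; exact: le_trans z0.
(* From $e^t \ge 1 + t$ at $t = x/y$: $z \ge y e^{x/y} \ge y + x \ge x$. *)
have /(ler_wpM2l (ltW y0)) := expR_ge1Dx (xc p / yc p).
rewrite mulrDr mulr1 mulrCA divff ?gt_eqF// mulr1 => yx.
have := expR_ge0 (xc p / yc p) => e0.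
have ye0 := mulr_ge0 (ltW y0) e0.
by split; lra.
Qed.

(** The three inequalities are closed conditions, so they pass to limits; this makes them available
    at boundary points. *)
Lemma closure_Kexp_bounds p :
  closure Kexp p -> [/\ 0 <= yc p, 0 <= zc p & xc p <= zc p].
Proof.
have closure_sub (f : 'rV[R]_3 -> R) : continuous f ->
    (forall v, Kexp v -> 0 <= f v) -> closure Kexp p -> 0 <= f p.
  move=> cf Kf; suff /closure_id fE : closed [set v | 0 <= f v].
    by move/(closureS Kf); rewrite -fE.
  apply: (@preimage_closed _ _ f [set x | 0 <= x]); last exact: closed_ge.
  by move=> ? _; exact: cf.
have coord i : continuous (fun v : 'rV[R]_3 => v 0 i).
  by exact: coord_continuous.
move=> Kp; split.
- by apply: (closure_sub _ (coord 1)) Kp => v /Kexp_bounds[].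
- by apply: (closure_sub _ (coord 2)) Kp => v /Kexp_bounds[].
- rewrite -subr_ge0; apply: (closure_sub (fun v => zc v - xc v)) Kp.
    by move=> v; exact: cvgB (coord 2 v) (coord 0 v).
  by move=> v /Kexp_bounds[_ _]; rewrite subr_ge0.
Qed.

Lemma Kexp_scale (s : R) p : 0 <= s -> Kexp p -> Kexp (s *: p).
Proof.
rewrite le_eqVlt => /predU1P[<- _|s0].
  by right; rewrite /= !coord3Z !mul0r lexx.
case=> [[y0 yz]|[x0 z0 y0]]; [left|right]; rewrite /= !coord3Z.
  rewrite mulr_gt0//; split=> //.
  by rewrite -mulf_div divff ?gt_eqF// mul1r -mulrA ler_pM2l.
by rewrite y0 mulr0 pmulr_rle0// mulr_ge0// ltW.
Qed.

Lemma Finf_proj w : exists2 u, is_proj Finf w u &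
  xc u = Num.min (xc w) 0.
Proof.
pose u : 'rV[R]_3 := Num.min (xc w) 0 *: delta_mx 0 0.
have [[ux uy] uz] : (xc u = Num.min (xc w) 0) * (yc u = 0) * (zc u = 0).
  by rewrite /u !coord3Z /xc /yc /zc !mxE/= !mulr0 mulr1.
exists u => //; split; first by split=> //; rewrite ux ge_min lexx orbT.
move=> p [px py pz]; apply: le_enorm; rewrite !inner3E !coord3B ux uy uz py pz.
rewrite !lerD2r -!expr2; case: (leP (xc w) 0) => xw.
  by rewrite subrr expr0n sqr_ge0.
by rewrite ler_sqr ?nnegrE; lra.
Qed.

Lemma orthocompl_Kexp z : xc z = 0 -> 0 < yc z -> 0 < zc z ->
  orthocompl [set z] `&` Kexp = Finf.
Proof.
move=> zx zy zz; apply/seteqP; split=> p.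
  move=> [/(_ z erefl) + Kp]; rewrite inner3E zx mulr0 add0r.
  have [y0 z0 _] := Kexp_bounds Kp => /eqP.
  rewrite paddr_eq0 ?mulr_ge0 ?(ltW zy) ?(ltW zz)//.
  rewrite !mulf_eq0 (gt_eqF zy) (gt_eqF zz) !orbF => /andP[/eqP py /eqP pz].
  by split=> //; case: Kp => [[+ _]|[]//]; rewrite py ltxx.
move=> [px py pz]; split; last by right; rewrite /= px py pz lexx.
by move=> _ ->; rewrite inner3E zx py pz mulr0 !mul0r !addr0.
Qed.

(** For [f] the projection of [v], the difference $v - f$ is $(\max(x,0), y, z)$ with $\max(x,0) \le
    z$, so $|v-f|^2 \le y^2 + 2z^2 \le 4(y+z)^2$. *)
Lemma Finf_dist_le v : closure Kexp v ->
  exists2 f, Finf f & enorm (v - f) <= 2 * (yc v + zc v).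
Proof.
move=> /closure_Kexp_bounds[y0 z0 xz].
have [f [[fx fy fz] _] fE] := Finf_proj v; exists f => //.
rewrite -ler_sqr ?nnegrE ?enorm_ge0//; last by lra.
rewrite sqr_enorm inner3E !coord3B fy fz fE.
by case: (leP (xc v) 0) => xv; nra.
Qed.

Lemma proj_ratio_ge z : xc z = 0 -> 0 < yc z -> 0 < zc z ->
  exists2 k : R, 0 < k & forall v w u, closure Kexp v ->
    orthocompl [set z] w -> is_proj Finf w u ->
    k * enorm (w - u) <= enorm (w - v).
Proof.
move=> zx zy zz; pose m := Num.min (yc z) (zc z).
have m0 : 0 < m by rewrite lt_min zy.
have my : m <= yc z by rewrite ge_min lexx.
have mz : m <= zc z by rewrite ge_min lexx orbT.
have N0 := enorm_ge0 z.
have d0 : 0 < m + 2 * enorm z by lra.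
(* The constant comes from $|w-u| \le |w-f| \le |w-v| + 2(v_y+v_z)$ combined with $m(v_y+v_z) \le
   |w-v|\,|z|$. *)
exists (m / (m + 2 * enorm z)); first by rewrite divr_gt0.
move=> v w u Kv /(_ z erefl) wz [_ wu].
have [f Ff vf] := Finf_dist_le Kv.
have [vy vz _] := closure_Kexp_bounds Kv.
(* As [w] is orthogonal to [z], the left side is at most $\langle v, z\rangle = \langle v-w,
   z\rangle$. *)
have mS : m * (yc v + zc v) <= enorm (w - v) * enorm z.
  rewrite enormB; apply: le_trans (inner_le _ _).
  by rewrite !inner_linear wz inner3E zx; nra.
have := ler_enormD (w - v) (v - f); rewrite addrA subrK => wf.
have wuf := wu f Ff.
by rewrite mulrAC ler_pdivrMr//; nra.
Qed.

(** The real [c] stands for $\max\{2, 2/\gamma\}$, which treats finite and infinite $\gamma$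
    together. The sum $1 + c/2$ from the path through [w] is at most [c] because $c \ge 2$. *)
Lemma Kexp_error_bound z q p (eta c : R) :
  xc z = 0 -> 0 < yc z -> 0 < zc z -> 2 <= c ->
  (forall v w u, ((boundary Kexp `&` eball eta) `\` Finf) v ->
     is_proj (orthocompl [set z]) v w -> is_proj Finf w u -> w <> u ->
     2 * enorm (w - u) <= c * enorm (w - v)) ->
  inner q z = 0 -> eball eta q -> Kexp p ->
  exists2 f, Finf f & enorm (q - f) <= c * enorm (q - p).
Proof.
move=> zx zy zz c2 Hc qz qeta Kp.
have z0 : z != 0 by apply: contraTneq zy => ->; rewrite /yc mxE ltxx.
have [Kq|nKq] := pselect (Kexp q).
  exists q; last first.
    by rewrite subrr enorm0 mulr_ge0 ?enorm_ge0//; lra.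
  by rewrite -(orthocompl_Kexp zx zy zz); split=> // _ ->.
have [r [r0 qrp rpq]] := closer_on_ray p q.
set a := r *: p in qrp rpq.
have [s s01 bv] := segment_meets_boundary (Kexp_scale r0 Kp : Kexp a) nKq.
set v := a + s *: (q - a) in bv; move: s01 => /andP[s0 s1].
have vE : v = (1 - s) *: a + s *: q.
  by rewrite /v scalerBr scalerBl scale1r addrCA addrC.
have qv : enorm (q - v) <= enorm (q - p).
  have -> : q - v = (1 - s) *: (q - a).
    by rewrite /v scalerBl scale1r opprD addrA.
  rewrite enormZ ger0_norm ?subr_ge0//; apply: le_trans qrp.
  by rewrite ler_piMl ?enorm_ge0// gerBl.
suff [f Ff qf] : exists2 f, Finf f & enorm (q - f) <= c * enorm (q - v).
  by exists f => //; apply: le_trans qf _; rewrite ler_wpM2l//; lra.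
have c0 : 0 <= c by lra.
have d0 := enorm_ge0 (q - v).
have cd := ler_wpM2r d0 c2.
have [Fv|nFv] := pselect (Finf v); first by exists v => //; lra.
(* [v] is a convex combination of [a] and [q], both of norm at most [enorm q]. *)
have veta : eball eta v.
  rewrite /eball/= vE; apply: le_trans (ler_enormD _ _) _.
  have s1' : 0 <= 1 - s by rewrite subr_ge0.
  rewrite (enormZ (1 - s)) (enormZ s) !ger0_norm//; apply: le_trans qeta.
  by have := ler_wpM2l s1' rpq; lra.
have [w pw qw] := orthocompl_is_proj v z0.
have [u pu _] := Finf_proj w.
exists u; first by case: pu.
(* [q] lies in the hyperplane, where [w] is nearest to [v]. *)
have wv : enorm (w - v) <= enorm (q - v).
  by rewrite enormB (enormB q); case: pw => _; apply=> _ ->.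
have := ler_enormD (q - w) (w - u); rewrite addrA subrK => qu.
have := qw q qz => qw'.
have [wu|wNu] := pselect (w = u).
  by rewrite -wu; lra.
have := Hc _ _ _ (conj (conj bv veta) nFv) pw pu wNu.
by have := ler_wpM2l c0 wv; lra.
Qed.

End ExponentialConeFacts.

(** * Passage to the infima *)

Theorem theorem4p8 (R : realType) (z : 'rV[R]_3) (eta : R)
    (hz : dual_cone Kexp z) (hzx : xc z = 0) (hzy : 0 < yc z) (hzz : 0 < zc z)
    (heta : 0 < eta) :
  [/\ orthocompl [set z] `&` Kexp = Finf,
      (0 < gamma z eta)%E &
      forall q : 'rV[R]_3, (orthocompl [set z] `&` eball eta) q ->
        (edist_to Finf q <=
           maxe 2%:E (2%:E * (gamma z eta)^-1) * edist_to Kexp q)%E].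
Proof.
have gamma_gt0 : (0 < gamma z eta)%E.
  have [k k0 Hk] := proj_ratio_ge hzx hzy hzz.
  apply: (@lt_le_trans _ _ k%:E); first by rewrite lte_fin.
  apply: le_ereal_inf_tmp => _ [v [w [u [[[[Kv _] _] _] [zw _] wu wNu ->]]]].
  rewrite lee_fin ler_pdivlMr; first exact: Hk.
  rewrite lt_neqAle enorm_ge0 andbT eq_sym; apply/eqP => /enorm_eq0/eqP.
  by rewrite subr_eq0 => /eqP.
split=> //; first exact: orthocompl_Kexp.
move=> q [/(_ z erefl) qz qeta].
(* Positivity of [gamma] makes the maximum a real number; dividing by it then reduces the bound to
   one point [p] of the cone at a time. *)
suff [c [cE c2 Hc]] : exists c : R,
    [/\ (maxe 2%:E (2%:E * (gamma z eta)^-1) = c%:E)%E, 2 <= c &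
    forall v w u, ((boundary Kexp `&` eball eta) `\` Finf) v ->
     is_proj (orthocompl [set z]) v w -> is_proj Finf w u -> w <> u ->
     2 * enorm (w - u) <= c * enorm (w - v)].
  have c0 : 0 < c by exact: lt_le_trans c2.
  rewrite cE -lee_pdivrMl//; apply: le_ereal_inf_tmp => _ [p Kp <-].
  have [f Ff qf] := Kexp_error_bound hzx hzy hzz c2 Hc qz qeta Kp.
  rewrite lee_pdivrMl// -EFinM; apply: le_trans (_ : (enorm (q - f))%:E <= _)%E.
    by apply: ereal_inf_lbound; exists f.
  by rewrite lee_fin.
have gamma_le v w u : ((boundary Kexp `&` eball eta) `\` Finf) v ->
     is_proj (orthocompl [set z]) v w -> is_proj Finf w u -> w <> u ->
     (gamma z eta <= (enorm (w - v) / enorm (w - u))%:E)%E.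
  by move=> ? ? ? ?; apply: ereal_inf_lbound; exists v, w, u.
case: (gamma z eta) gamma_gt0 gamma_le => [g||//] g0 gamma_le.
  rewrite lte_fin in g0; exists (Num.max 2 (2 / g)).
  split=> [||v w u bv pw pu wNu].
  - by rewrite inver gt_eqF// -EFinM EFin_max.
  - by rewrite le_max lexx.
  have wu0 : 0 < enorm (w - u).
    rewrite lt_neqAle enorm_ge0 andbT eq_sym; apply/eqP => /enorm_eq0/eqP.
    by rewrite subr_eq0 => /eqP.
  have := gamma_le _ _ _ bv pw pu wNu; rewrite lee_fin ler_pdivlMr// => gwu.
  apply: (@le_trans _ _ (2 / g * enorm (w - v))).
    by rewrite mulrAC ler_pdivlMr// -mulrA ler_pM2l// mulrC.
  by rewrite ler_wpM2r ?enorm_ge0// le_max lexx orbT.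
(* Here [gamma] is infinite, so its inverse is 0. An admissible triple would bound [gamma] by a real
   ratio, so the last condition is vacuous. *)
exists 2; split=> // [|v w u bv pw pu wNu].
  by rewrite invey mule0; apply/max_idPl; rewrite lee_fin.
by have := gamma_le _ _ _ bv pw pu wNu.
Qed.
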